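(* Let $K(n)=\sum_{i=1}^{n}1_A(i)$ be the arithmetic function counting the elements of a set $A$ of natural numbers that do not exceed $n$. Let $K$ correspond to an equally probable random variable with values $K(1),K(2),\dots,K(n)$ on the probability space $(\Omega_n,\mathcal{A}_n,\mathbb{P}_n)$ constructed on the initial interval $\{1,\dots,n\}$ of the natural series. Let the probabilities on the spaces from $(\Omega_1,\mathcal{A}_1,\mathbb{P}_1)$ to $(\Omega_n,\mathcal{A}_n,\mathbb{P}_n)$ also be given: $p_1=K(1)/1,\dots,p_n=K(n)/n$. Then, for $K(i)=C\,i/\ln^k(i)$, where $C$ is a real number and $k$ is a natural number, the following asymptotic holds as $n\to\infty$: $$K(n)\sim\sum_{i=3}^{n}\frac{K(i)}{i}=\sum_{i=3}^{n}p_i .$$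
   Context: $1_A$ is the indicator function of $A$; in the intended application $A$ is a set of prime objects (such as primes or twin primes), so that $K(n)$ is the number of such objects not exceeding $n$. For each natural number $n$, the probability space $(\Omega_n,\mathcal{A}_n,\mathbb{P}_n)$ has $\Omega_n=\{1,2,\dots,n\}$, $\mathcal{A}_n$ the family of all subsets of $\Omega_n$, and $\mathbb{P}_n(B)=\#\{m\in B\}/n$ for $B\subseteq\Omega_n$; an arithmetic function $f$ is regarded as the random variable $x_n(m)=f(m)$, $1\le m\le n$, on this space. Thus $p_i=K(i)/i=\mathbb{P}_i(A\cap\Omega_i)$. $\ln^k(i)$ denotes $(\ln i)^k$, and $f(n)\sim g(n)$ denotes asymptotic equality as $n\to\infty$ (the ratio tends to 1).
   Formalization: The exact identity K(i)=C i/ln^k(i) is impossible for a counting function when k≥1 and C≠0 (and undefined at i=1), so it is read as the asymptotic equality K(i) ~ C i/ln^k(i); this excludes C=0, where the claimed ratio would be 0/0. *)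

(* Defs.v *)
From HB Require Import structures.
From mathcomp Require Import all_boot all_order all_algebra finmap.
From mathcomp Require Import all_classical all_reals all_analysis.

Set Implicit Arguments.
Unset Strict Implicit.
Unset Printing Implicit Defensive.

Import Order.TTheory GRing.Theory Num.Theory numFieldNormedType.Exports.

Local Open Scope classical_set_scope.
Local Open Scope ring_scope.

(* Since x / 0 = 0, a ratio tending to 1 forces g n != 0 for all large n. *)
Definition asymp_eq (R : realType) (f g : nat -> R) : Prop :=
  (fun n => f n / g n) @ \oo --> (1 : R).

(* The sum starts at 1, so 0 is never counted, even when it lies in A. *)
Definition counting_fun (R : realType) (A : set nat) (n : nat) : R :=
  \sum_(1 <= i < n.+1) \1_A i.

(* The sample space {1, ..., n} for n >= 1. A measurableType must be inhabited,
   hence the junk value Omega 0 = {1}. *)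
Definition Omega (n : nat) : Type := seq_sub (iota 1 (maxn n 1)).

HB.instance Definition _ (n : nat) := Finite.on (Omega n).

Fact one_in_Omega (n : nat) : 1%N \in iota 1 (maxn n 1).
Proof. by rewrite mem_iota/= ltnS leq_max orbT. Qed.

HB.instance Definition _ (n : nat) :=
  isPointed.Build (Omega n) (SeqSub (one_in_Omega n)).

HB.instance Definition _ (n : nat) :=
  @isMeasurable.Build default_measure_display (Omega n)
    discrete_measurable discrete_measurable0
    discrete_measurableC discrete_measurableU.

Definition event (A : set nat) (n : nat) : set (Omega n) :=
  [set m | A (val m)].

Definition unifP (R : realType) (n : nat) (B : set (Omega n)) : \bar R :=
  (#|` fset_set B|%:R / (maxn n 1)%:R)%:E.

Arguments event : clear implicits.
Arguments unifP : clear implicits.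

Section unifP_probability.
Context (R : realType) (n : nat).

Let r : {nonneg R} := ((maxn n 1)%:R^-1)%:nng.

Let unifP_counting :
  unifP R n = mscale r (@counting (Omega n) R).
Proof.
apply/funext => B.
have cB : counting B = (#|` fset_set B|%:R)%:E :> \bar R.
  by rewrite /counting asboolT//; exact: finite_finset.
by rewrite /unifP /mscale/= cB EFinM muleC.
Qed.

Let unifP0 : unifP R n set0 = 0%E.
Proof. by rewrite unifP_counting measure0. Qed.

Let unifP_ge0 (B : set (Omega n)) : (0 <= unifP R n B)%E.
Proof. by rewrite unifP_counting. Qed.

Let unifP_sigma_additive : semi_sigma_additive (unifP R n).
Proof. by rewrite unifP_counting; exact: measure_semi_sigma_additive. Qed.

HB.instance Definition _ := isMeasure.Build _ _ _ (unifP R n)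
  unifP0 unifP_ge0 unifP_sigma_additive.

Let unifP_setT : unifP R n setT = 1%E.
Proof.
rewrite /unifP; suff -> : #|` fset_set [set: Omega n]| = maxn n 1.
  by rewrite divff// pnatr_eq0 -lt0n leq_max orbT.
have eT : perm_eq (fset_set [set: Omega n]) (enum {: Omega n}).
  apply: uniq_perm; rewrite ?fset_uniq ?enum_uniq// => m.
  rewrite mem_enum in_fset_set; last exact: finite_finset.
  by rewrite mem_setT.
rewrite (perm_size eT) -cardE card_seq_sub ?iota_uniq//.
exact: size_iota.
Qed.

HB.instance Definition _ :=
  Measure_isProbability.Build _ _ _ (unifP R n) unifP_setT.

End unifP_probability.

(* Main.v *)
(** Put [G n = n / (ln n)^k] and let [S n] be the sum on the right-hand side.
    Since [n * ((ln (n+1) / ln n)^k - 1)] tends to [0], the increments of [G]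
    are equivalent to [1 / (ln n)^k], so those of [S] are equivalent to [C]
    times those of [G]. As [G] tends to infinity, the Stolz-Cesaro theorem
    gives that [S / G] tends to [C], and [K / G] tends to [C] by hypothesis.
    The hypothesis excludes [C = 0] because then every ratio is [_ / 0 = 0]. *)

Require Import Defs.
From mathcomp Require Import all_boot all_order all_algebra finmap.
From mathcomp Require Import all_classical all_reals all_analysis.
From mathcomp Require Import ring lra.

Set Implicit Arguments.
Unset Strict Implicit.
Unset Printing Implicit Defensive.

Import Order.TTheory GRing.Theory Num.Theory numFieldNormedType.Exports.

Local Open Scope classical_set_scope.
Local Open Scope ring_scope.

(** Past some rank [N], each increment of [u - l * v] is at most [e / 2] times that of [v] in
    absolute value. These bounds telescope, and dividing by [v n] makes the contribution of rank [N]
    negligible. *)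
Lemma stolz_cesaro (R : realType) (u v : nat -> R) (l : R) :
  (\forall n \near \oo, v n < v n.+1) -> v @ \oo --> +oo ->
  (fun n => (u n.+1 - u n) / (v n.+1 - v n)) @ \oo --> l ->
  (fun n => u n / v n) @ \oo --> l.
Proof.
move=> v_incr v_oo duv; apply/cvgrPdist_le => e e0.
have e20 : 0 < e / 2 by rewrite divr_gt0.
have [N _ HN] : \forall n \near \oo, v n < v n.+1 /\
    `|l - (u n.+1 - u n) / (v n.+1 - v n)| <= e / 2.
  by near=> n; split; near: n => //; exact: (cvgrPdist_le _ _).1.
have step n : (N <= n)%N ->
    `|(u n - l * v n) - (u N - l * v N)| <= e / 2 * (v n - v N).
  move=> /subnKC <-; elim: (n - N)%N => [|m IH].
    by rewrite addn0 !subrr normr0 mulr0.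
  rewrite addnS; have [vlt] := HN (N + m)%N (leq_addr _ _).
  set i := (N + m)%N in IH vlt *.
  have d0 : 0 < v i.+1 - v i by rewrite subr_gt0.
  rewrite -(ler_pM2r d0) -[X in `|_| * X](gtr0_norm d0) -normrM mulrBl.
  rewrite divfK ?gt_eqF//; move: IH; rewrite !ler_norml => /andP[? ?] /andP[? ?]; lra.
near=> n.
have vn0 : 0 < v n by near: n; exact: ((cvgryPgt _).1 v_oo).
(* This threshold makes the terms frozen at rank [N] cost at most [e / 2 * v n], so the total error
   is at most [e * v n]. *)
have large : (`|u N - l * v N| + e / 2 * `|v N|) / (e / 2) <= v n.
  by near: n; exact: ((cvgryPge _).1 v_oo).
have /step : (N <= n)%N by near: n; exact: nbhs_infty_ge.
move=> near_v; rewrite distrC -(ler_pM2r vn0) -[X in `|_| * X](gtr0_norm vn0).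
rewrite -normrM mulrBl divfK ?gt_eqF//.
move: large near_v; rewrite ler_pdivrMr//.
have := ler_norm (u N - l * v N); have := ler_norm (- (u N - l * v N)).
have := ler_norm (- v N); rewrite !normrN.
rewrite !ler_norml => h1 h2 h3 h4 /andP[h5 h6]; apply/andP; nra.
Unshelve. all: end_near. Qed.

Lemma near_succn (P : set nat) :
  (\forall n \near \oo, P n) -> \forall n \near \oo, P n.+1.
Proof. by move=> [N _ NP]; exists N => // n /= Nn; apply: NP; exact: leqW. Qed.

Lemma near_eq_cvgn (R : realType) (f g : nat -> R) (l l' : R) :
  f @ \oo --> l -> (\forall n \near \oo, f n = g n) -> l = l' ->
  g @ \oo --> l'.
Proof. by move=> fl fg <-; apply: cvg_trans fl; exact: near_eq_cvg. Qed.

Lemma cvgy_ln_nat (R : realType) : ln (n%:R : R) @[n --> \oo] --> +oo.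
Proof.
apply/cvgryPge => M; near=> n.
have Mn : expR M <= n%:R by near: n; exact: nbhs_infty_ger.
by rewrite -[M]expRK ler_ln// posrE ?expR_gt0// (lt_le_trans (expR_gt0 M)).
Unshelve. all: end_near. Qed.

Lemma near_ln_nat_gt0 (R : realType) : \forall n \near \oo, 0 < ln (n%:R : R).
Proof. by have /cvgryPgt := @cvgy_ln_nat R; exact. Qed.

(** Since ln(n+1) = ln n + ln(1 + 1/n) and 0 <= ln(1 + 1/n) <= 1/n, the expression lies between 0
    and 1/ln n. *)
Lemma cvg_ln_ratio (R : realType) :
  n%:R * (ln n.+1%:R / ln n%:R - 1 : R) @[n --> \oo] --> (0 : R).
Proof.
apply: (@squeeze_cvgr _ _ _ _ (fun=> 0) (fun n => (ln n%:R)^-1)).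
- near=> n.
  have L0 : 0 < ln (n%:R : R) by near: n; exact: near_ln_nat_gt0.
  have n0 : (0 : R) < n%:R by rewrite ltr0n; near: n; exact: nbhs_infty_gt.
  have -> : ln n.+1%:R = ln n%:R + ln (1 + n%:R^-1) :> R.
    rewrite -lnM ?posrE ?addr_gt0 ?invr_gt0//.
    by rewrite mulrDr mulr1 divff ?gt_eqF// natr1.
  rewrite mulrDl divff ?gt_eqF// addrAC subrr add0r mulrA.
  apply/andP; split.
    by rewrite divr_ge0 ?(ltW L0)// mulr_ge0// ln_ge0// lerDl invr_ge0.
  rewrite -[leRHS]mul1r ler_pM2r ?invr_gt0// mulrC -ler_pdivlMr// div1r le_ln1Dx//.
  by rewrite (lt_trans (ltrN10 _))// invr_gt0.
- exact: cvg_cst.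
- by apply/gtr0_cvgV0; [exact: near_ln_nat_gt0|exact: cvgy_ln_nat].
Unshelve. all: end_near. Qed.

(** Induction on [k]: with q = ln(n+1)/ln n, q^(k+1) - 1 = q (q^k - 1) + (q - 1), where q tends to
    1. *)
Lemma cvg_lnX_ratio (R : realType) (k : nat) :
  n%:R * ((ln n.+1%:R / ln n%:R) ^+ k - 1 : R) @[n --> \oo] --> (0 : R).
Proof.
have q1 : (ln n.+1%:R / ln n%:R : R) @[n --> \oo] --> (1 : R).
  have n0 : ((n%:R : R)^-1) @[n --> \oo] --> (0 : R).
    apply/gtr0_cvgV0; last exact: cvgr_idn.
    by near=> n; rewrite ltr0n; near: n; exact: nbhs_infty_gt.
  (* For n > 0, q = n^-1 * (n (q - 1)) + 1, and both factors of the product tend to 0. *)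
  apply: (near_eq_cvgn
    (cvgD (cvgM n0 (@cvg_ln_ratio R)) (cvg_cst (1 : R)))); last first.
    by rewrite mul0r add0r.
  near=> n; rewrite !fctE /= mulKf ?subrK// pnatr_eq0 -lt0n.
  by near: n; exact: nbhs_infty_gt.
elim: k => [|k IH].
  by under eq_fun do rewrite expr0 subrr mulr0; exact: cvg_cst.
apply: (near_eq_cvgn (cvgD (cvgM q1 IH) (@cvg_ln_ratio R))); last first.
  by rewrite mulr0 addr0.
by near=> n; rewrite !fctE /= exprS; ring.
Unshelve. all: end_near. Qed.

(** Multiplying out gives exactly 1 - n (q^k - 1) with q = ln(n+1)/ln n, once ln n > 0. *)
Lemma cvg_increment_div_lnX (R : realType) (k : nat) :
  (n.+1%:R / ln n.+1%:R ^+ k - n%:R / ln n%:R ^+ k) * ln n.+1%:R ^+ k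
    @[n --> \oo] --> (1 : R).
Proof.
apply: (near_eq_cvgn (cvgB (cvg_cst (1 : R)) (@cvg_lnX_ratio R k)));
  last by rewrite subr0.
near=> n.
have L0 : 0 < ln (n%:R : R) by near: n; exact: near_ln_nat_gt0.
have L1 : 0 < ln (n.+1%:R : R).
  by near: n; exact: (near_succn (near_ln_nat_gt0 R)).
rewrite !fctE /= expr_div_n mulrBl divfK ?expf_neq0 ?gt_eqF// -natr1.
by ring.
Unshelve. all: end_near. Qed.

(** The exponential series at x = ln n gives n >= 1 + x^(k+1)/(k+1)!, so the quotient is at least ln
    n/(k+1)!. *)
Lemma cvgy_div_lnX (R : realType) (k : nat) :
  n%:R / ln n%:R ^+ k @[n --> \oo] --> (+oo : set_system R).
Proof.
apply/cvgryPge => M; near=> n.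
have L0 : 0 < ln (n%:R : R) by near: n; exact: near_ln_nat_gt0.
have n0 : (0 : R) < n%:R by rewrite ltr0n; near: n; exact: nbhs_infty_gt.
have Ln : M * k.+1`!%:R <= ln (n%:R : R).
  by near: n; have /cvgryPge := @cvgy_ln_nat R; exact.
rewrite ler_pdivlMr ?exprn_gt0//.
have := expR_ge1Dxn k (ltW L0); rewrite lnK ?posrE//; apply: le_trans.
rewrite exprS mulrAC -[leLHS]add0r lerD// ler_pM2r ?exprn_gt0//.
by rewrite ler_pdivlMr// ltr0n fact_gt0.
Unshelve. all: end_near. Qed.

Lemma counting_fun_div (R : realType) (A : set nat) (i : nat) (q : R) :
  (0 < i)%N -> q%:E = unifP R i (event A i) -> counting_fun R A i / i%:R = q.
Proof.
move=> i0 [->]; rewrite (maxn_idPl i0); congr (_ / _).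
rewrite /counting_fun.
have finE : finite_set (event A i) by exact: finite_finset.
(* [val] enumerates [Omega i] as the list 1, ..., max(i, 1), so the cardinality becomes a count
   along that list. *)
have -> : #|` fset_set (event A i)| =
    count [pred m | m \in A] (iota 1 (maxn i 1)).
  rewrite -[X in count _ X](val_seq_sub_enum (iota_uniq _ _)) count_map.
  rewrite -size_filter; apply: perm_size; apply: uniq_perm => //.
    by rewrite filter_uniq// undup_uniq.
  move=> m; rewrite in_fset_set// mem_filter mem_seq_sub_enum andbT /=.
  by apply/idP/idP; rewrite !inE.
rewrite (maxn_idPl i0) -sum1_count natr_sum [RHS]big_mkcond /= /index_iota subn1.
by apply: eq_bigr => j _; rewrite indicE; case: (j \in A).
Qed.

Theorem mainTheorem2 (R : realType) (A : set nat) (K : nat -> R)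
    (x : forall n : nat, {RV unifP R n >-> R}) (p : nat -> R)
    (C : R) (k : nat)
    (hK : forall n : nat, K n = counting_fun R A n)
    (hx : forall (n : nat) (m : Omega n), x n m = K (val m))
    (hp : forall i : nat, (0 < i)%N -> (p i)%:E = unifP R i (event A i))
    (hKC : asymp_eq K (fun i => C * i%:R / ln i%:R ^+ k)) :
  asymp_eq K (fun n => \sum_(3 <= i < n.+1) K i / i%:R) /\
  (forall n : nat,
    \sum_(3 <= i < n.+1) K i / i%:R = \sum_(3 <= i < n.+1) p i).
Proof.
split; last first.
  move=> n; apply: eq_big_nat => i /andP[i3 _].
  have i0 : (0 < i)%N by exact: leq_trans i3.
  by rewrite hK; apply: counting_fun_div => //; exact: hp.
have C0 : C != 0.
  apply: contraPneq hKC => ->; rewrite /asymp_eq.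
  under eq_fun do rewrite !mul0r invr0 mulr0.
  move=> /(cvg_unique (@Rhausdorff R) (cvg_cst (0 : R)))/eqP.
  by rewrite eq_sym oner_eq0.
set S := fun n => \sum_(3 <= i < n.+1) K i / i%:R.
pose G n : R := n%:R / ln n%:R ^+ k.
have dG := @cvg_increment_div_lnX R k.
have SG : (fun n => S n / G n) @ \oo --> C.
  apply: stolz_cesaro; [|exact: cvgy_div_lnX|].
    near=> n.
    have L1 : 0 < ln (n.+1%:R : R).
      by near: n; exact: (near_succn (near_ln_nat_gt0 R)).
    (* The increment of [G] times the positive ln(n+1)^k tends to 1, so it is eventually
       positive. *)
    rewrite -subr_gt0 -(pmulr_lgt0 _ (exprn_gt0 k L1)).
    by near: n; exact: (cvgr_gt 1 dG).
  have KS : (fun n => K n.+1 / (C * n.+1%:R / ln n.+1%:R ^+ k)) @ \oo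
      --> (1 : R) by move: hKC; rewrite /asymp_eq -cvg_shiftS.
  (* With L = ln(n+1)^k, the quotient of increments is C times K(n+1)/(C(n+1)/L) times the inverse
     of (G(n+1) - G(n)) L; the last two factors tend to 1. *)
  apply: (near_eq_cvgn
    (cvgM (cvgM (cvg_cst C) KS) (cvgV (oner_neq0 R) dG))); last first.
    by rewrite invr1 !mulr1.
  near=> n.
  have L1 : ln (n.+1%:R : R) ^+ k != 0.
    rewrite expf_neq0// gt_eqF//.
    by near: n; exact: (near_succn (near_ln_nat_gt0 R)).
  (* The sum starts at 3, so its last term, of index n+1, can be split off only when n+1 >= 3. *)
  have n2 : (2 <= n)%N by near: n; exact: nbhs_infty_ge.
  have -> : S n.+1 - S n = K n.+1 / n.+1%:R.
    by rewrite /S [X in X - _]big_nat_recr//= addrAC subrr add0r.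
  rewrite /= -/(G n.+1) -/(G n) !invfM invrK.
  set L := ln _ ^+ k in L1 *.
  transitivity ((C / C) * (L / L) * (K n.+1 / n.+1%:R / (G n.+1 - G n))).
    by ring.
  by rewrite !divff// !mul1r.
(* K/S = (K/(C G)) * C * (S/G)^-1, which tends to 1 * C * C^-1. *)
apply: (near_eq_cvgn (cvgM (cvgM hKC (cvg_cst C)) (cvgV C0 SG)));
  last by rewrite mul1r mulfV.
near=> n.
have G0 : G n != 0.
  by rewrite gt_eqF//; near: n; exact: ((cvgryPgt _).1 (@cvgy_div_lnX R k)).
rewrite /= -[C * n%:R / _]mulrA -/(G n); move: (G n) G0 => g g0.
rewrite !invfM invrK.
transitivity ((C / C) * (g / g) * (K n / S n)); first by ring.
by rewrite !divff// !mul1r.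
Unshelve. all: end_near. Qed.
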